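(* For every integer $n \geq 1$, let $B_n^{(3)}$ be the triangular book graph with vertex set $\{a, b, c_1, \dots, c_n\}$ and edge set $\{ab\} \cup \{ac_i, bc_i : 1 \leq i \leq n\}$ (order $n+2$, size $2n+1$). Then $$s\left(B_n^{(3)}\right) = \begin{cases} 3, & \text{if } n = 1, \\ \left\lceil \frac{n+1}{2} \right\rceil, & \text{if } n \geq 2. \end{cases}$$
   Context: The triangular book graph $B_n^{(3)}$ consists of $n$ triangles sharing a common edge $ab$. For a simple graph $G$, an edge $k$-labeling $f: E(G) \to \{1, 2, \dots, k\}$ is a vertex irregular edge $k$-labeling (irregular assignment) if the vertex weights $w_f(u) = \sum_{uv \in E(G)} f(uv)$ are pairwise distinct over all vertices $u$ of $G$. The irregularity strength $s(G)$ is the minimum $k$ for which $G$ admits a vertex irregular edge $k$-labeling, and $s(G) = \infty$ if no such labeling exists. *)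

(* Defs.v *)
From mathcomp Require Import all_boot.
From mathcomp Require Import boolp.

Set Implicit Arguments.
Unset Strict Implicit.
Unset Printing Implicit Defensive.

Record sgraph := SGraph {
  vertex :> finType;
  edges : {set {set vertex}};
  card_edge : forall e, e \in edges -> #|e| = 2 }.

(* A labeling is a total function on vertex sets; only its values on the edges
   of G are ever constrained or used. *)
Definition edge_labeling (G : sgraph) (k : nat) (f : {set G} -> nat) : Prop :=
  forall e, e \in edges G -> 1 <= f e <= k.

Definition vertex_weight (G : sgraph) (f : {set G} -> nat) (u : G) : nat :=
  \sum_(v : G | [set u; v] \in edges G) f [set u; v].

Definition irregular_labeling (G : sgraph) (k : nat) (f : {set G} -> nat) :
    Prop :=
  edge_labeling k f /\ injective (vertex_weight f).

(* [None] stands for the value infinity. *)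
Definition irregularity_strength (G : sgraph) : option nat :=
  match pselect (exists k, `[< exists f, @irregular_labeling G k f >]) with
  | left ex_k => Some (ex_minn ex_k)
  | right _ => None
  end.

Section Book.
Variable n : nat.

Definition book_vertex : finType := (bool + 'I_n)%type.

Definition book_a : book_vertex := inl true.
Definition book_b : book_vertex := inl false.
Definition book_c (i : 'I_n) : book_vertex := inr i.

Definition book_edges : {set {set book_vertex}} :=
  [set book_a; book_b] |:
    ([set [set book_a; book_c i] | i : 'I_n] :|:
     [set [set book_b; book_c i] | i : 'I_n]).

Lemma card_book_edge (e : {set book_vertex}) : e \in book_edges -> #|e| = 2.
Proof.
rewrite in_setU1 in_setU => /orP[/eqP->|/orP[]]; first by rewrite cards2.
  by case/imsetP=> i _ ->; rewrite cards2.
by case/imsetP=> i _ ->; rewrite cards2.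
Qed.

Definition triangular_book : sgraph := SGraph card_book_edge.

Lemma order_triangular_book : #|triangular_book| = n + 2.
Proof. by rewrite card_sum card_bool card_ord addnC. Qed.

Lemma size_triangular_book : #|edges triangular_book| = 2 * n + 1.
Proof.
have memE (x y z : book_vertex) : (z \in [set x; y]) = (z == x) || (z == y).
  by rewrite !inE.
have card_spokes (x : bool) :
    #|[set [set (inl x : book_vertex); book_c i] | i : 'I_n]| = n.
  rewrite card_imset ?card_ord // => i j /setP/(_ (book_c i)).
  by rewrite !memE eqxx orbT /= => /esym/eqP[].
rewrite /= /book_edges cardsU1 cardsU !card_spokes.
have -> : [set [set book_a; book_c i] | i : 'I_n] :&:
          [set [set book_b; book_c i] | i : 'I_n] = set0.
  apply/setP=> e; rewrite in_set0 in_setI; apply/negP=> /andP[].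
  case/imsetP=> i _ -> /imsetP[j _] /setP/(_ book_a).
  by rewrite !memE eqxx.
have -> : [set book_a; book_b] \notin
          [set [set book_a; book_c i] | i : 'I_n] :|:
          [set [set book_b; book_c i] | i : 'I_n].
  rewrite in_setU; apply/norP; split; apply/imsetP=> -[i _] /setP/(_ (book_c i));
    by rewrite !memE eqxx orbT.
by rewrite cards0 subn0 addnC addnn mul2n.
Qed.

End Book.

(* Main.v *)
Require Import Defs.
From mathcomp Require Import all_boot.
From mathcomp Require Import boolp zify.

(** The weight of a page vertex [c_i] is a sum of two labels in [1..k], so
    distinctness of the [n] page weights forces [n <= 2k - 1].  Conversely
    label [a c_i] and [b c_i] by the upper and lower halves of [i + 2]
    ([0 <= i < n]) and the spine [ab] by [ceil((n+1)/2)]: the pages get weights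
    [2, ..., n+1], and as soon as [n >= 2] both spine vertices exceed [n+1],
    with [a] strictly above [b] because of page [i = 1].  The triangle
    ([n = 1]) needs three distinct labels. *)

Set Implicit Arguments.
Unset Strict Implicit.
Unset Printing Implicit Defensive.

Section IrregularityStrength.

Variable G : sgraph.

(** Trades the [pselect] and [ex_minn] of the definition for an attained value and a lower bound. *)
Lemma irregularity_strength_eqP (k : nat) :
  (exists f, @irregular_labeling G k f) ->
  (forall m, (exists f, @irregular_labeling G m f) -> k <= m) ->
  irregularity_strength G = Some k.
Proof.
move=> exk mink; rewrite /irregularity_strength.
case: pselect => [ex_k|[]]; last by exists k; apply/asboolP.
case: ex_minnP => m /asboolP exm minm; congr Some; apply/eqP.
by rewrite eqn_leq mink // minm //; apply/asboolP.
Qed.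

End IrregularityStrength.

Section BookWeights.

Variable n : nat.
Implicit Types (f : {set triangular_book n} -> nat) (x y : bool) (i j : 'I_n).

Lemma book_spineE x y :
  ([set (inl x : triangular_book n); inl y] \in edges (triangular_book n))
    = (x != y).
Proof.
apply/idP/idP => [/card_edge|]; first by case: eqP => // ->; rewrite setUid cards1.
case: x y => [] [] // _; rewrite !inE ?eqxx //.
by rewrite setUC eqxx.
Qed.

Lemma book_spoke x i :
  [set (inl x : triangular_book n); inr i] \in edges (triangular_book n).
Proof.
rewrite in_setU1 in_setU; case: x; apply/or3P.
  by apply: Or32; apply/imsetP; exists i.
by apply: Or33; apply/imsetP; exists i.
Qed.

(** Every edge contains [inl true] or [inl false]; a set of two pages contains neither. *)
Lemma book_pagesN i j :
  ([set (inr i : triangular_book n); inr j] \in edges (triangular_book n))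
    = false.
Proof.
apply/negP; rewrite in_setU1 in_setU.
move=> /or3P[/eqP/setP/(_ (inl true))|/imsetP[l _ /setP/(_ (inl true))]
            |/imsetP[l _ /setP/(_ (inl false))]]; by rewrite !inE.
Qed.

Lemma weight_page f i :
  vertex_weight f (inr i : triangular_book n) =
    f [set book_a n; book_c i] + f [set book_b n; book_c i].
Proof.
rewrite /vertex_weight big_mkcond big_sumType /=.
rewrite [X in _ + X]big1 ?addn0 => [|j _]; last by rewrite book_pagesN.
by rewrite big_bool /= ![[set inr i; _]]setUC !book_spoke.
Qed.

Lemma weight_spine f x :
  vertex_weight f (inl x : triangular_book n) =
    f [set book_a n; book_b n] +
    \sum_i f [set (inl x : triangular_book n); book_c i].
Proof.
rewrite /vertex_weight big_mkcond big_sumType big_bool /= !book_spineE.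
congr (_ + _); last by apply: eq_bigr => i _; rewrite book_spoke.
by case: x; rewrite //= addn0 setUC.
Qed.

Lemma book_strength_ge k f : 0 < n -> irregular_labeling k f -> uphalf n.+1 <= k.
Proof.
move=> n_gt0 [lab_f inj_f].
(* Subtraction is truncated, but [0 < n] excludes [k = 0]. *)
have: n <= 2 * k - 1; last by move: n_gt0; lia.
pose ws := [seq vertex_weight f (inr i : triangular_book n) | i : 'I_n].
have <- : size ws = n by rewrite size_map size_enum_ord.
(* The page weights are distinct members of [[2..2k]], which this [iota] lists. *)
rewrite -(size_iota 2 (2 * k - 1)); apply: uniq_leq_size.
  by rewrite map_inj_uniq ?enum_uniq // => i j /inj_f[].
move=> w /mapP[i _ ->]; rewrite mem_iota weight_page.
have : 1 <= f [set book_a n; book_c i] <= k := lab_f _ (book_spoke true i).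
have : 1 <= f [set book_b n; book_c i] <= k := lab_f _ (book_spoke false i).
by lia.
Qed.

(** Labels are functions of sets, so the edge is decoded by membership. An edge has at most one
    page, hence [pick] is unambiguous; the spine has none and falls to [t]. *)
Definition book_label (t : nat) (p q : 'I_n -> nat)
    (e : {set triangular_book n}) : nat :=
  if [pick i | book_c i \in e] is Some i
  then if book_a n \in e then p i else q i
  else t.

Section BookLabel.

Variables (t : nat) (p q : 'I_n -> nat).

Lemma book_label_spine : book_label t p q [set book_a n; book_b n] = t.
Proof. by rewrite /book_label; case: pickP => // i; rewrite !inE. Qed.

Lemma book_label_spoke x i :
  book_label t p q [set (inl x : triangular_book n); book_c i] =
    if x then p i else q i.
Proof.
rewrite /book_label; case: pickP => [j|/(_ i)]; last by rewrite !inE eqxx orbT.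
by rewrite !inE /= => /eqP[->]; case: x.
Qed.

(** The last four hypotheses separate page from page, [a] from [b] (where the common [t] cancels),
    and each spine vertex from the pages. *)
Lemma irregular_book_label k :
    1 <= t <= k ->
    (forall i, 1 <= p i <= k) -> (forall i, 1 <= q i <= k) ->
    injective (fun i => p i + q i) ->
    \sum_i p i != \sum_i q i ->
    (forall i, p i + q i != t + \sum_j p j) ->
    (forall i, p i + q i != t + \sum_j q j) ->
  irregular_labeling k (book_label t p q).
Proof.
move=> tk pk qk inj_pq neq_ab neq_a neq_b; split.
  move=> e; rewrite in_setU1 in_setU.
  move=> /or3P[/eqP->|/imsetP[i _ ->]|/imsetP[i _ ->]].
  - by rewrite book_label_spine.
  - by rewrite book_label_spoke.
  - by rewrite book_label_spoke.
have wc i : vertex_weight (book_label t p q) (inr i : triangular_book n)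
            = p i + q i by rewrite weight_page !book_label_spoke.
have ws x : vertex_weight (book_label t p q) (inl x : triangular_book n)
            = t + \sum_i (if x then p i else q i).
  rewrite weight_spine book_label_spine; congr (_ + _).
  by apply: eq_bigr => i _; rewrite book_label_spoke.
have neq_s x i : p i + q i <> t + \sum_j (if x then p j else q j).
  by apply/eqP; case: x.
move=> [x|i] [y|j]; rewrite ?wc ?ws.
- move=> /addnI; case: x y => [] [] // /eqP; first by rewrite (negPf neq_ab).
  by rewrite eq_sym (negPf neq_ab).
- by move=> /esym/neq_s.
- by move=> /neq_s.
- by move=> /inj_pq ->.
Qed.

End BookLabel.

Lemma book_strength_le :
  1 < n -> exists f, @irregular_labeling (triangular_book n) (uphalf n.+1) f.
Proof.
move=> n_gt1; pose p i := (uphalf i).+1; pose q i := i./2.+1.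
have sum_q : n <= \sum_(i < n) q i.
  by rewrite -{1}(card_ord n) -sum1_card; apply: leq_sum.
have sum_pq : \sum_(i < n) q i < \sum_(i < n) p i.
  (* Page 1 is isolated: there [p] is 2 and [q] is 1, while [q <= p] on all others. *)
  rewrite (bigD1 (Ordinal n_gt1)) //= [ltnRHS](bigD1 (Ordinal n_gt1)) //=.
  rewrite -addSn; apply: leq_add => //.
  by apply: leq_sum => i _; rewrite /p /q; lia.
have pqE i : p i + q i = i.+2 by rewrite /p /q; lia.
(* Pages weigh at most [n + 1]; since [n >= 2], the spine label is at least 2 and the right side at
   least [n + 2]. *)
have page_lt (i : 'I_n) s : n <= s -> p i + q i != uphalf n.+1 + s.
  by rewrite pqE; move: (ltn_ord i); lia.
exists (book_label (uphalf n.+1) p q); apply: irregular_book_label.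
- by lia.
- by move=> i; rewrite /p; move: (ltn_ord i); lia.
- by move=> i; rewrite /q; move: (ltn_ord i); lia.
- by move=> i j; rewrite !pqE => -[/val_inj].
- by rewrite neq_ltn sum_pq orbT.
- by move=> i; apply: page_lt; apply: leq_trans sum_q (ltnW sum_pq).
- by move=> i; apply: page_lt.
Qed.

End BookWeights.

Lemma triangle_strength_le :
  exists f, @irregular_labeling (triangular_book 1) 3 f.
Proof.
(* The weights of [a], [b] and the page are 4, 5 and 3. *)
exists (book_label 3 (fun=> 1) (fun=> 2)).
apply: irregular_book_label => // [i j _||i|i]; rewrite ?big_ord1 //.
by rewrite (ord1 i) (ord1 j).
Qed.

(** Any two vertices of a triangle share an edge whose label cancels when their weights are
    compared, so the three labels differ pairwise. *)
Lemma triangle_strength_ge k (f : {set triangular_book 1} -> nat) :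
  irregular_labeling k f -> 3 <= k.
Proof.
move=> [lab_f inj_f].
have neq_w u v : u != v -> vertex_weight f u != vertex_weight f v.
  by apply: contraNneq => /inj_f ->.
have := neq_w (book_a 1) (book_b 1) isT.
have := neq_w (book_a 1) (book_c ord0) isT.
have := neq_w (book_b 1) (book_c ord0) isT.
rewrite weight_page !weight_spine !big_ord1.
set x := f [set _; book_b 1]; set y := f [set book_a 1; book_c _].
set z := f [set book_b 1; book_c _].
have : 1 <= x <= k by apply: lab_f; rewrite book_spineE.
have : 1 <= y <= k := lab_f _ (book_spoke true ord0).
have : 1 <= z <= k := lab_f _ (book_spoke false ord0).
by lia.
Qed.

(* uphalf m is the ceiling of m / 2 *)
Theorem theorem1 (n : nat) (hn : 1 <= n) :
  irregularity_strength (triangular_book n) =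
    Some (if n == 1 then 3 else uphalf n.+1).
Proof.
have [->|n_neq1] := eqVneq n 1; apply: irregularity_strength_eqP.
- exact: triangle_strength_le.
- by move=> m [f]; apply: triangle_strength_ge.
- by apply: book_strength_le; lia.
- by move=> m [f]; apply: book_strength_ge.
Qed.
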